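(* Let $\Gamma=C_2^{*3}\times C_3=\langle a_1,a_2,a_3,b : a_i^2=[a_i,b]=b^3=1\ (i=1,2,3)\rangle$ with generating set $E=\{a_1,a_2,a_3,b\}$. Then $\mathrm{Cay}(\Gamma,E)$ admits a $\Gamma$-fiid (proper vertex) $3$-coloring.
   Context: $\mathrm{Cay}(\Gamma,E)$ is the graph with vertex set $\Gamma$ in which $x$ is adjacent to $\gamma x$ for $\gamma\in E\cup E^{-1}$. $\Gamma$ acts on $[0,1]^\Gamma$ and on $\{1,2,3\}^\Gamma$ by $(\gamma\cdot x)(\delta)=x(\delta\gamma)$. A $\Gamma$-fiid $3$-coloring is a measurable map $\mathbf f:([0,1]^\Gamma,\lambda^\Gamma)\to\{1,2,3\}^\Gamma$ ($\lambda$ Lebesgue measure) that is $\Gamma$-equivariant almost everywhere and whose value is almost surely a proper vertex coloring of $\mathrm{Cay}(\Gamma,E)$. *)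

(* Defs.v *)
From HB Require Import structures.
From mathcomp Require Import all_boot all_order all_algebra fingroup.
From mathcomp Require Import boolp classical_sets reals ereal.
From mathcomp Require Import measure lebesgue_measure.

Set Implicit Arguments.
Unset Strict Implicit.
Unset Printing Implicit Defensive.

Import Order.TTheory GRing.Theory Num.Theory.

Local Open Scope classical_set_scope.
Local Open Scope ring_scope.

(* An element is its normal form: a word in the letters 'I_n (the n generating
   involutions) without two equal consecutive letters. *)
Definition reduced n (w : seq 'I_n) : bool :=
  sorted (fun i j : 'I_n => i != j) w.

Record c2free (n : nat) := C2Free {
  c2word :> seq 'I_n;
  _ : reduced c2word
}.

HB.instance Definition _ n := [isSub for @c2word n].
HB.instance Definition _ n := [Choice of c2free n by <:].

Section C2Free.
Variable n : nat.
Implicit Types (i : 'I_n) (w v : seq 'I_n) (x y z : c2free n).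

Lemma c2wordP x : reduced x. Proof. by case: x. Qed.

(* lett i w is the normal form of i :: w, redcat w v that of w ++ v. *)
Definition lett i w : seq 'I_n :=
  if w is j :: w' then if i == j then w' else i :: w else [:: i].

Definition redcat w v : seq 'I_n := foldr lett v w.

Lemma reduced_lett i w : reduced w -> reduced (lett i w).
Proof.
case: w => [//|j w] /= jw; case: (eqVneq i j) => [_|ij].
  exact: path_sorted jw.
by rewrite /reduced /= ij.
Qed.

Lemma reduced_redcat w v : reduced v -> reduced (redcat w v).
Proof. by move=> rv; elim: w => //= i w; exact: reduced_lett. Qed.

Lemma lettK i w : reduced w -> lett i (lett i w) = w.
Proof.
case: w => [|j w] /=; first by rewrite eqxx.
case: (eqVneq i j) => [->|ij _] /=; last by rewrite eqxx.
by case: w => [//|k w] /=; rewrite /reduced /= => /andP[/negPf->].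
Qed.

Lemma redcat_lett i w v :
  reduced v -> redcat (lett i w) v = lett i (redcat w v).
Proof.
move=> rv; case: w => [//|j w] /=; case: (eqVneq i j) => [->|//].
by rewrite lettK //; exact: reduced_redcat.
Qed.

Lemma redcatA u w v : reduced v ->
  redcat u (redcat w v) = redcat (redcat u w) v.
Proof. by move=> rv; elim: u => //= i u ->; rewrite redcat_lett. Qed.

Lemma redcat0 w : reduced w -> redcat w [::] = w.
Proof.
elim: w => //= i w IHw riw; rewrite IHw; last exact: path_sorted riw.
by case: w riw {IHw} => [//|j w] /=; rewrite /reduced /= => /andP[/negPf->].
Qed.

Lemma reduced_rev w : reduced w -> reduced (rev w).
Proof.
rewrite /reduced rev_sorted; apply: sub_sorted => i j /=.
by rewrite eq_sym.
Qed.

Lemma redcat_cat u w v : redcat (u ++ w) v = redcat u (redcat w v).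
Proof. exact: foldr_cat. Qed.

Lemma redcat_rev w v : reduced v -> redcat (rev w) (redcat w v) = v.
Proof.
move=> rv; elim: w => //= i w IHw.
by rewrite rev_cons -cats1 redcat_cat /= lettK ?IHw //; exact: reduced_redcat.
Qed.

Definition c2one : c2free n := @C2Free n [::] isT.
Definition c2mul x y := C2Free (reduced_redcat x (c2wordP y)).
Definition c2inv x := C2Free (reduced_rev (c2wordP x)).

Lemma c2mulA : associative c2mul.
Proof. by move=> x y z; apply: val_inj; apply: redcatA; exact: c2wordP. Qed.

Lemma c2mul1 : left_id c2one c2mul.
Proof. by move=> x; apply: val_inj. Qed.

Lemma c2mulr1 : right_id c2one c2mul.
Proof. by move=> x; apply: val_inj; apply: redcat0; exact: c2wordP. Qed.

Lemma c2mulV : left_inverse c2one c2inv c2mul.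
Proof.
move=> x; apply: val_inj; rewrite /= -[X in redcat _ X]redcat0 ?redcat_rev //.
exact: c2wordP.
Qed.

Lemma c2mulrV : right_inverse c2one c2inv c2mul.
Proof.
move=> x; apply: val_inj; rewrite /= -[X in redcat X]revK.
by rewrite -[X in redcat _ X]redcat0 ?redcat_rev ?reduced_rev //; exact: c2wordP.
Qed.

HB.instance Definition _ :=
  isGroup.Build (c2free n) c2mulA c2mul1 c2mulr1 c2mulV c2mulrV.

Definition c2gen i : c2free n := @C2Free n [:: i] isT.

End C2Free.

(* As a multiplicative group, 'Z_3 is Z/3Z under addition: C_3. *)
Definition Gamma : groupType := (c2free 3 * 'Z_3)%type.

Definition gen_a (i : 'I_3) : Gamma := (c2gen i, 1%g).
Definition gen_b : Gamma := (1%g, 1%R).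

Definition genE : set Gamma := [set g | (exists i, g = gen_a i) \/ g = gen_b].

(* The next two lemmas say that Gamma is the group presented by
   < a_1, a_2, a_3, b : a_i^2 = [a_i, b] = b^3 = 1 >. *)
Lemma Gamma_relations :
  [/\ forall i, (gen_a i ^+ 2 = 1)%g,
      forall i, ([~ gen_a i, gen_b] = 1)%g & (gen_b ^+ 3 = 1)%g].
Proof.
have aa i : (gen_a i * gen_a i = 1)%g.
  congr (_, _); last exact: mulg1.
  by apply: val_inj; rewrite /= eqxx.
split.
- by move=> i; exact: aa.
- move=> i; apply/eqP; apply/commgP; congr (_, _); first by rewrite mulg1 mul1g.
  by rewrite /= mulg1 mul1g.
- congr (_, _); first by rewrite /= !mul1g.
  exact: val_inj.
Qed.

Lemma Gamma_universal (H : groupType) (a : 'I_3 -> H) (b : H) :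
  (forall i, a i ^+ 2 = 1)%g -> (forall i, [~ a i, b] = 1)%g -> (b ^+ 3 = 1)%g ->
  exists! phi : Gamma -> H,
    [/\ forall x y, phi (x * y)%g = (phi x * phi y)%g,
        forall i, phi (gen_a i) = a i & phi gen_b = b].
Proof.
move=> a2 ab b3.
have aa i : (a i * a i = 1)%g by exact: a2.
have cab i : commute b (a i) by apply: commute_sym; apply/commgP/eqP/ab.
have a_cancel i h : (a i * (a i * h) = h)%g by rewrite mulgA aa mul1g.
pose ev (w : seq 'I_3) : H := (\prod_(i <- w) a i)%g.
have ev_cons i w : ev (i :: w) = (a i * ev w)%g by rewrite /ev big_cons.
have ev_lett i w : ev (lett i w) = (a i * ev w)%g.
  case: w => [|j w] /=; first by rewrite ev_cons.
  by case: (eqVneq i j) => [->|ij]; rewrite !ev_cons ?a_cancel.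
have ev_redcat w v : ev (redcat w v) = (ev w * ev v)%g.
  elim: w => [|i w IHw] /=; first by rewrite {2}/ev big_nil mul1g.
  by rewrite ev_lett IHw ev_cons mulgA.
have c_ev w m : commute (b ^+ m)%g (ev w).
  apply: commute_sym; apply: commuteX; apply: commute_sym.
  elim: w => [|i w IHw]; first by rewrite /ev big_nil; exact: commute1.
  by rewrite ev_cons; apply: commuteM.
have bmod m : (b ^+ (m %% 3) = b ^+ m)%g.
  by rewrite [in RHS](divn_eq m 3) expgnDr mulnC expgM b3 expg1n mul1g.
pose phi (x : Gamma) : H := (ev x.1 * b ^+ x.2)%g.
have phiM x y : phi (x * y)%g = (phi x * phi y)%g.
  rewrite /phi /= ev_redcat bmod expgnDr -!mulgA; congr (_ * _)%g.
  by rewrite !mulgA; congr (_ * _)%g; rewrite c_ev.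
exists phi; split.
  split=> // [i|]; rewrite /phi /=.
    by rewrite ev_cons /ev big_nil !mulg1.
  by rewrite /ev big_nil mul1g.
move=> psi [psiM psia psib]; apply: boolp.funext => -[[w rw] k].
have psi1 : psi 1%g = 1%g.
  by apply: (mulgI (psi 1%g)); rewrite -psiM !mulg1.
have word : psi (C2Free rw, 1%g) = ev w.
  elim: w rw => [|i w IHw] rw.
    by rewrite /ev big_nil -psi1; congr (psi (_, _)); exact: val_inj.
  rewrite ev_cons -psia -(IHw (path_sorted rw)) -psiM; congr psi.
  congr (_, _); last by rewrite mulg1.
  apply: val_inj => /=.
  by case: w rw {IHw} => [//|j w] /=; rewrite /reduced /= => /andP[/negPf->].
have psib_pow : psi (1%g, k) = (b ^+ k)%g.
  case: k => [[|[|[|//]]] lt3] /=.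
  - rewrite (_ : (_, _) = 1%g) ?psi1 //.
    by congr (_, _); exact: val_inj.
  - rewrite (_ : (_, _) = gen_b) ?psib //.
    by congr (_, _); exact: val_inj.
  - rewrite (_ : (_, _) = gen_b * gen_b)%g ?psiM ?psib //.
    by congr (_, _); [rewrite mul1g | exact: val_inj].
rewrite /phi /= -word -psib_pow -psiM; congr psi.
by congr (_, _); rewrite ?mulg1 ?mul1g.
Qed.

Definition cay_adj (G : groupType) (E : set G) (x y : G) : Prop :=
  exists2 g : G, E g \/ E (g^-1)%g & y = (g * x)%g.

Definition proper_coloring (V C : Type) (adj : V -> V -> Prop) (c : V -> C) :=
  forall x y, adj x y -> c x <> c y.

Definition shift (G : groupType) (T : Type) (g : G) (x : G -> T) : G -> T :=
  fun d => x (d * g)%g.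

Definition cylinders (I : Type) d (T : measurableType d) : set (set (I -> T)) :=
  [set C | exists i (A : set T), measurable A /\ C = [set x | A (x i)]].

Definition prodM (I : Type) d (T : measurableType d) :=
  g_sigma_algebraType (@cylinders I d T).

(* P is the product measure mu^I: the product formula holds on all finite-
   dimensional measurable boxes. By the pi-lambda theorem this determines P. *)
Definition is_product_measure (R : realType) (I : choiceType) d
    (T : measurableType d) (mu : set T -> \bar R)
    (P : {measure set (prodM I T) -> \bar R}) : Prop :=
  forall (J : seq I) (A : I -> set T), uniq J ->
    (forall i, measurable (A i)) ->
    P [set x | forall i, i \in J -> A i (x i)] = (\prod_(i <- J) mu (A i))%E.

Definition unit_interval (R : realType) : Type := {x : R | x \in `[0, 1]%R}.

Definition ival (R : realType) (x : unit_interval R) : R := sval x.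

Fact zero_in01 (R : realType) : (0 : R)%R \in `[0, 1]%R.
Proof. by rewrite in_itv /= lexx ler01. Qed.

HB.instance Definition _ (R : realType) := Choice.on (unit_interval R).
HB.instance Definition _ (R : realType) :=
  isPointed.Build (unit_interval R)
    (exist (fun x : R => x \in `[0, 1]%R) 0 (zero_in01 R)).
(* Trace of the Borel sigma-algebra of R. *)
HB.instance Definition _ (R : realType) :=
  Measurable.copy (unit_interval R) (g_sigma_algebra_preimageType (@ival R)).

Definition lebesgue01 (R : realType) (A : set (unit_interval R)) : \bar R :=
  lebesgue_measure (@ival R @` A).

(* The colors 1, 2, 3 are the ordinals 0, 1, 2; every set of colors is
   measurable. *)
Definition color := 'I_3.

HB.instance Definition _ := Choice.on color.
HB.instance Definition _ := isPointed.Build color ord0.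
HB.instance Definition _ := @isMeasurable.Build default_measure_display color
  discrete_measurable discrete_measurable0 discrete_measurableC
  discrete_measurableU.

(* For countable G, as here, it does not matter whether the exceptional null
   set of equivariance may depend on g. *)
Definition is_fiid_3coloring (R : realType) (G : groupType) (E : set G)
    (P : {measure set (prodM G (unit_interval R)) -> \bar R})
    (f : prodM G (unit_interval R) -> prodM G color) : Prop :=
  [/\ measurable_fun setT f,
      {ae P, forall x, forall g : G, f (shift g x) = shift g (f x)} &
      {ae P, forall x, proper_coloring (cay_adj E) (f x)}].

(* Main.v *)
Require Import Defs.
From HB Require Import structures.
From mathcomp Require Import all_boot all_order all_algebra fingroup.
From mathcomp Require Import boolp classical_sets reals ereal.
From mathcomp Require Import sequences measure lebesgue_measure.
From mathcomp Require Import zify lra.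

(** Write W for the free product of three copies of C_2, so that Gamma is the
    product of W and C_3, and the Cayley graph is the product of the 3-regular
    tree with a triangle.  An equivariant f is determined by F x = f x 1, via
    f x g = F (g x).  We look for F with F (b x) = F x + 1 in Z/3, which colours
    every triangle properly; what remains is F (a_i x) <> F x for i = 1, 2, 3.

    Consider partial colourings F : X -> option Z/3 obeying these rules, and call
    x a hole when F x = None.  A hole can be pushed along any edge of the tree:
    once the vertex a_i x is declared a hole, only two neighbours of x restrict
    the colour of x, so x can be coloured (slide, slide_conflict_free).  Pushing
    a hole along a path until it reaches another hole destroys it, and changes
    the colouring only along the path (merge_holes, merge_dist).  If this has been
    done for all pairs of holes at distance at most 4n, then the remaining holes
    are more than 4n apart; the tree has 2^n vertices pairwise at distance at most
    4n, so translates of the set of holes can be packed and the hole density is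
    of order 2^-n (packing, few_holes).  The measure of the set of changed points
    is at most 8n times the previous density, since each hole that disappears is
    paid for by a path of bounded length.  Iterating with n = 0, 2, 4, ... these
    measures are summable, so by Borel-Cantelli almost every point is recoloured
    finitely often and ends up coloured (limit_coloring).

    To push many holes at once, measurably and equivariantly, one needs active
    sets whose points are far apart, so that the paths do not interfere, and on
    which the C_3-symmetry is broken, so that a colour can be selected.  Both are
    provided by the labels: a marker at x records in which position of the
    triangle of x a prescribed digit occurs, provided that this digit occurs
    nowhere else in a large ball.  Since digits of distinct coordinates rarely
    coincide, finitely many markers reach all points up to a small probability
    (mark_is_marker, markers).  The argument before this step works for any
    measure-preserving action of Gamma that has markers. *)

Set Implicit Arguments.
Unset Strict Implicit.
Unset Printing Implicit Defensive.

Import Order.TTheory GRing.Theory Num.Theory.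

Local Open Scope classical_set_scope.
Local Open Scope ring_scope.

Local Notation W := (c2free 3).

(** * The free product of three copies of C_2 *)

Definition word_prod (w : seq 'I_3) : W := (\prod_(i <- w) c2gen i)%g.

Lemma word_prod_cons i w : word_prod (i :: w) = (c2gen i * word_prod w)%g.
Proof. by rewrite /word_prod big_cons. Qed.

Lemma c2gen_redcat i (u : W) : c2word (c2gen i * u)%g = lett i u.
Proof. by []. Qed.

Lemma word_prod_redcat w : c2word (word_prod w) = redcat w [::].
Proof.
elim: w => [|i w IHw]; first by rewrite /word_prod big_nil.
by rewrite word_prod_cons c2gen_redcat IHw.
Qed.

Lemma word_prodK (g : W) : word_prod g = g.
Proof. by apply: val_inj; rewrite /= word_prod_redcat redcat0 // c2wordP. Qed.

Lemma c2gen_neq1 i : c2gen i != 1%g :> W.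
Proof. by []. Qed.

Lemma size_lett i (w : seq 'I_3) : (size (lett i w) <= (size w).+1)%N.
Proof. by case: w => //= j w; case: eqP => //= _; apply: leqW. Qed.

Lemma size_c2mul (u v : W) : (size (u * v)%g <= size u + size v)%N.
Proof.
have -> : c2word (u * v)%g = redcat u v by [].
elim: (c2word u) => //= i w IHw; apply: leq_trans (size_lett _ _) _.
by rewrite addSn ltnS.
Qed.

Lemma size_c2inv (u : W) : size (u^-1)%g = size u.
Proof. exact: size_rev. Qed.

Lemma size_word_prod w : (size (word_prod w) <= size w)%N.
Proof.
rewrite word_prod_redcat; elim: w => //= i w IHw.
exact: leq_trans (size_lett _ _) _.
Qed.

(** * Pushing holes through a partial colouring *)

Section Combinatorics.
Variables (X : Type) (act : Gamma -> X -> X).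
Hypothesis act1 : forall x, act 1%g x = x.
Hypothesis actM : forall g h x, act (g * h)%g x = act g (act h x).

Definition tact (w : W) : X -> X := act (w, 1%g).
Definition turn : X -> X := act gen_b.
Local Notation a i := (tact (c2gen i)).

Implicit Types (F S : X -> option 'Z_3) (i j : 'I_3) (x : X) (u v w : W).

Lemma tactM u v x : tact (u * v)%g x = tact u (tact v x).
Proof. by rewrite /tact -actM; congr act; congr pair; rewrite mulg1. Qed.

Lemma tact1 x : tact 1%g x = x.
Proof. exact: act1. Qed.

Lemma tactVK u x : tact u (tact u^-1%g x) = x.
Proof. by rewrite -tactM mulgV tact1. Qed.

Lemma tact_turn u x : tact u (turn x) = turn (tact u x).
Proof. by rewrite /tact /turn -!actM; congr act; congr pair; rewrite ?mulg1 ?mul1g. Qed.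

Lemma c2gen_sq i : (c2gen i * c2gen i = 1 :> W)%g.
Proof. by apply: val_inj; rewrite /= eqxx. Qed.

Lemma aK i x : a i (a i x) = x.
Proof. by rewrite -tactM c2gen_sq tact1. Qed.

Definition equivariant F := forall x, F (turn x) = omap (fun c => c + 1) (F x).

Definition conflict_free F := forall i x c, F x = Some c -> F (a i x) <> Some c.

(** Distances are measured in the tree only: the three points of a triangle may
    all be marked. *)
Definition sparse n S := forall w, (size w <= n)%N -> w != 1%g ->
  forall x, S x <> None -> S (tact w x) = None.

Definition blocked i F x : pred 'Z_3 :=
  fun d => [exists j, (j != i) && (F (a j x) == Some d)].

(** Searching upwards from [c] commutes with rotating the colours, whereas taking
    the least free colour would not. *)
Definition first_free (B : pred 'Z_3) (c : 'Z_3) : 'Z_3 :=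
  if ~~ B c then c else if ~~ B (c + 1) then c + 1 else c + 1 + 1.

(** [S] serves both as the set of points that act, namely where it is not [None],
    and as the reference colour from which an acting point starts its search.
    Each acting x is coloured, at the price of a_i x becoming a hole. *)
Definition slide S i F : X -> option 'Z_3 := fun x =>
  if S x is Some c then Some (first_free (blocked i F x) c)
  else if S (a i x) is Some _ then None else F x.

(** Two neighbours cannot forbid three colours. *)
Lemma first_freeP i F x c : ~~ blocked i F x (first_free (blocked i F x) c).
Proof.
rewrite /first_free; case: ifPn => // /negPn/existsP[j0 /andP[j0i /eqP e0]].
case: ifPn => // /negPn/existsP[j1 /andP[j1i /eqP e1]].
apply/negP => /existsP[j2 /andP[j2i /eqP e2]].
have n01 : j0 != j1.
  by apply/eqP => E; move: e1; rewrite -E e0; case: (c) => -[|[|[|]]].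
have n02 : j0 != j2.
  by apply/eqP => E; move: e2; rewrite -E e0; case: (c) => -[|[|[|]]].
have n12 : j1 != j2.
  by apply/eqP => E; move: e2; rewrite -E e1; case: (c) => -[|[|[|]]].
rewrite -!(inj_eq val_inj) /= in j0i j1i j2i n01 n02 n12.
move: (ltn_ord i) (ltn_ord j0) (ltn_ord j1) (ltn_ord j2); lia.
Qed.

Lemma first_free_rot (B B' : pred 'Z_3) c :
  (forall d, B' (d + 1) = B d) -> first_free B' (c + 1) = first_free B c + 1.
Proof. by rewrite /first_free => BB; rewrite !BB; case: ifP => // _; case: ifP. Qed.

Lemma slide_equivariant S i F :
  equivariant S -> equivariant F -> equivariant (slide S i F).
Proof.
move=> eS eF x; rewrite /slide eS; case: (S x) => [c|] /=.
  congr Some; apply: first_free_rot => d; apply: eq_existsb => j.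
  rewrite tact_turn eF; case: (F _) => //= e; congr andb.
  by rewrite !(inj_eq (@Some_inj _)) (inj_eq (addIr _)).
by rewrite tact_turn eS; case: (S _) => [c|] /=; last exact: eF.
Qed.

Lemma slide_conflict_free S i F : (forall j x, S x <> None -> S (a j x) = None) ->
  conflict_free F -> conflict_free (slide S i F).
Proof.
move=> indep pF.
have one_side j x c : S x <> None ->
    slide S i F x = Some c -> slide S i F (a j x) <> Some c.
  move=> Sx; have Sjx := indep j x Sx; rewrite /slide Sjx.
  case ES: (S x) Sx => [c0|//] _ [<-].
  case: (eqVneq j i) => [->|ji]; first by rewrite aK ES.
  case: (S _) => // Fjx; have /existsPn/(_ j) := first_freeP i F x c0.
  by rewrite ji Fjx eqxx.
move=> j x c e; case ES: (S x) => [c0|].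
  by apply: one_side => //; rewrite ES.
case ES': (S (a j x)) => [c0|].
  move=> /(one_side j); by rewrite ES' aK => h; apply: h e.
move: e; rewrite /slide ES ES'.
case: (S (a i x)) => // Fx; case: (S _) => //; exact: pF.
Qed.

(** The acting points of [S], displaced by v and keeping their reference colour. *)
Definition translate S v x := S (tact v^-1%g x).

(** The word is read from its last letter, so that the hole starting at x ends at
    [tact (word_prod w) x]. *)
Fixpoint walk S (w : seq 'I_3) F : X -> option 'Z_3 :=
  if w is i :: v then slide (translate S (word_prod v)) i (walk S v F) else F.

Lemma translate_equivariant S v : equivariant S -> equivariant (translate S v).
Proof. by move=> eS x; rewrite /translate tact_turn eS. Qed.

Lemma walk_equivariant S (w : seq 'I_3) F :
  equivariant S -> equivariant F -> equivariant (walk S w F).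
Proof.
move=> eS eF; elim: w => //= i v IH.
by apply: slide_equivariant => //; apply: translate_equivariant.
Qed.

(** Two points displaced by v that are neighbours come from points that differ by
    a conjugate of a generator, of length at most 2|v|+1; sparsity excludes it. *)
Lemma walk_conflict_free n S (w : seq 'I_3) F : sparse n S -> ((size w).*2 <= n.+1)%N ->
  conflict_free F -> conflict_free (walk S w F).
Proof.
move=> sS; elim: w => //= i v IH wn pF; apply: slide_conflict_free; last first.
  by apply: IH => //; lia.
move=> j x; rewrite /translate; set p := word_prod v => Sx.
have -> : tact p^-1%g (a j x) = tact (p^-1 * c2gen j * p)%g (tact p^-1%g x).
  by rewrite !tactM tactVK.
apply: sS => //.
  have sp := size_word_prod v; rewrite -/p in sp.
  have := size_c2mul (p^-1 * c2gen j)%g p; have := size_c2mul (p^-1)%g (c2gen j).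
  rewrite size_c2inv /=. lia.
have -> : (p^-1 * c2gen j * p = c2gen j ^ p)%g by rewrite /conjg mulgA.
by rewrite conjg_eq1 c2gen_neq1.
Qed.

Lemma slide_None S i F x : slide S i F x = None ->
  S x = None /\ (S (a i x) <> None \/ F x = None).
Proof.
by rewrite /slide; case: (S x) => //; case: (S _) => [c _|->]; split=> //; [left|right].
Qed.

(** During the walk each acting point is vacated by its hole, and the only new
    holes are the current positions of the travelling ones. *)
Lemma walk_None S (w : seq 'I_3) F x : walk S w F x = None ->
  (F x = None /\ S x = None) \/ translate S (word_prod w) x <> None.
Proof.
elim: w => [|i v IH] /=.
  rewrite /translate /word_prod big_nil invg1 tact1 => ->.
  by case: (S x) => [c|]; [right | left].
move=> /slide_None[Sv [Sw|/IH[|//]]]; [right | by left].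
move: Sw; rewrite /translate word_prod_cons invgM tactM.
suff -> : ((c2gen i)^-1 = c2gen i :> W)%g by [].
exact: val_inj.
Qed.

Lemma slide_eq S i F x : S x = None -> S (a i x) = None -> slide S i F x = F x.
Proof. by rewrite /slide => -> ->. Qed.

Definition active S F w x := if F x is None then
  if F (tact w x) is None then S x else None else None.

Lemma activeP S F w x : active S F w x <> None ->
  [/\ F x = None, F (tact w x) = None & S x <> None].
Proof. by rewrite /active; case: (F x) => //; case: (F _). Qed.

Lemma active_equivariant S F w :
  equivariant S -> equivariant F -> equivariant (active S F w).
Proof.
move=> eS eF x; rewrite /active tact_turn !eF eS.
by case: (F x) => //=; case: (F _).
Qed.

Lemma active_sparse n S F w : sparse n S -> sparse n (active S F w).
Proof.
move=> sS v vn v1 x /activeP[_ _ Sx]; rewrite /active (sS _ vn v1 _ Sx).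
by case: (F _) => //; case: (F _).
Qed.

Definition merge_holes S w F := walk (active S F w) w F.

(** The end point of a walk was a hole already, and by sparsity it is not itself a
    starting point: merging creates no hole and fills all starting points. *)
Lemma merge_None n S w F x : sparse n S -> (size w <= n)%N -> w != 1%g ->
  merge_holes S w F x = None -> F x = None /\ active S F w x = None.
Proof.
move=> sS wn w1 /walk_None[//|]; rewrite word_prodK /translate => Sy.
have [_ Fx _] := activeP Sy; rewrite tactVK in Fx; split=> //.
by rewrite -[x](tactVK w); exact: (active_sparse sS wn w1 Sy).
Qed.

End Combinatorics.

(** * Countably valued measurable functions *)

Section DiscreteMeasurable.
Context (d : measure_display) (X : measurableType d).

(** Measurability for the discrete sigma-algebra on the codomain.  On countable
    types it is stable under arbitrary case analysis ([dmeas_bind]), which covers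
    all the constructions below. *)
Definition dmeas (T : Type) (F : X -> T) := forall Y : set T, measurable (F @^-1` Y).

Lemma dmeas_cst T (t : T) : dmeas (fun=> t).
Proof.
move=> Y; have [Yt|Yt] := pselect (Y t).
  by rewrite (_ : _ @^-1` _ = setT) //; apply/seteqP; split.
by rewrite (_ : _ @^-1` _ = set0) //; apply/seteqP; split.
Qed.

Lemma dmeas_comp T1 T2 (h : T1 -> T2) (F : X -> T1) :
  dmeas F -> dmeas (fun x => h (F x)).
Proof. by move=> mF Y; exact: (mF (h @^-1` Y)). Qed.

Lemma dmeas_bind (T1 : countType) T2 (F : X -> T1) (G : T1 -> X -> T2) :
  dmeas F -> (forall t, dmeas (G t)) -> dmeas (fun x => G (F x) x).
Proof.
move=> mF mG Y.
rewrite (_ : _ @^-1` Y = \bigcup_n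
  (F @^-1` [set t | pickle t = n] `&`
   (if unpickle n is Some t then G t @^-1` Y else set0))).
  apply: bigcupT_measurable => n; apply: measurableI; first exact: mF.
  by case: unpickle => // t; exact: mG.
apply/seteqP; split => [x Yx|x [n _ [/= <-]]]; last by rewrite pickleK.
by exists (pickle (F x)) => //; split=> //=; rewrite pickleK.
Qed.

Lemma dmeas_filter T (l : seq T) (B : T -> X -> bool) :
  (forall t, dmeas (B t)) -> dmeas (fun x => [seq t <- l | B t x]).
Proof.
move=> mB; elim: l => [|t l IH] /=; first exact: dmeas_cst.
apply: (@dmeas_bind bool _ (B t) (fun b x => if b then _ else _)) => // -[] //.
exact: dmeas_comp IH.
Qed.

Lemma dmeas_has T (l : seq T) (B : T -> X -> bool) :
  (forall t, dmeas (B t)) -> dmeas (fun x => has (B^~ x) l).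
Proof.
move=> mB; rewrite (_ : (fun _ => _) = fun x => (0 < size [seq t <- l | B t x])%N).
  by apply: (dmeas_comp (fun s => 0 < size s)%N); exact: dmeas_filter.
by apply/funext => x; rewrite size_filter has_count.
Qed.

Lemma dmeas_set T (F : X -> T) (Q : T -> Prop) :
  dmeas F -> measurable [set x | Q (F x)].
Proof. by move=> mF; exact: (mF [set t | Q t]). Qed.

Lemma dmeas_pair (T1 : countType) T2 (F : X -> T1) (G : X -> T2) :
  dmeas F -> dmeas G -> dmeas (fun x => (F x, G x)).
Proof.
move=> mF mG; apply: (@dmeas_bind _ _ F (fun t x => (t, G x))) => // t.
exact: (dmeas_comp (pair t)).
Qed.

Lemma dmeas_set2 (T1 : countType) T2 (F : X -> T1) (G : X -> T2) (Q : T1 -> T2 -> Prop) :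
  dmeas F -> dmeas G -> measurable [set x | Q (F x) (G x)].
Proof.
by move=> mF mG; exact: (dmeas_pair mF mG [set p | Q p.1 p.2]).
Qed.

Lemma dmeas_nat (F : X -> nat) : (forall m, measurable [set x | F x = m]) -> dmeas F.
Proof.
move=> mF Y; rewrite (_ : F @^-1` Y = \bigcup_(m in Y) [set x | F x = m]).
  by apply: bigcup_measurable => m _; exact: mF.
by apply/seteqP; split => [x Yx|x [m Ym /= ->]] //; exists (F x).
Qed.

Lemma dmeas_asbool (A : set X) : measurable A -> dmeas (fun x => `[< A x >]).
Proof.
move=> mA Y; rewrite (_ : _ @^-1` Y = (if `[< Y true >] then A else set0) `|`
    (if `[< Y false >] then ~` A else set0)).
  by apply: measurableU; case: ifP => // _; exact: measurableC.
apply/seteqP; split => x /=.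
  by case: (asboolP (A x)) => Ax Yx; [left|right]; rewrite asboolT.
by case=> [|]; case: asboolP => // Yx Ax; [rewrite asboolT|rewrite asboolF].
Qed.

(** Three disjoint measurable events decide the limit colour; where the sequence
    does not settle the value is arbitrary. *)
Lemma dmeas_limit (F : nat -> X -> option 'Z_3) :
  (forall k, dmeas (F k)) -> exists L : X -> 'Z_3, dmeas L /\
    forall x c N, (forall k, (N <= k)%N -> F k x = Some c) -> L x = c.
Proof.
move=> mF.
pose E c := \bigcup_N \bigcap_(k in [set k | (N <= k)%N]) [set x | F k x = Some c].
have mE c : measurable (E c).
  apply: bigcupT_measurable => N; apply: bigcap_measurableType => k _.
  exact: (dmeas_set (fun s => s = Some c)).
have E_uniq c c' x : E c x -> E c' x -> c = c'.
  move=> [N _ EN] [N' _ EN'].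
  have := EN (maxn N N') (leq_maxl _ _); rewrite /= EN' /= ?leq_maxr//.
  by case.
exists (fun x => if `[< E 0 x >] then 0 else if `[< E 1 x >] then 1 else 2); split.
  apply: (@dmeas_bind bool _ (fun x => `[< E 0 x >])
    (fun b x => if b then 0 else if `[< E 1 x >] then 1 else 2)).
    exact: dmeas_asbool.
  case; first exact: dmeas_cst.
  exact: (dmeas_comp (fun b : bool => if b then 1 else 2) (dmeas_asbool (mE 1))).
move=> x c N FN; have Ec : E c x by exists N.
case: asboolP => [E0|n0]; first exact: E_uniq E0 Ec.
case: asboolP => [E1|n1]; first exact: E_uniq E1 Ec.
have c0 : c <> 0 by move=> c0; apply: n0; rewrite -c0.
have c1 : c <> 1 by move=> c1; apply: n1; rewrite -c1.
case: c c0 c1 {Ec FN} => -[|[|[|//]]] lt c0 c1; last exact: val_inj.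
  by case: c0; exact: val_inj.
by case: c1; exact: val_inj.
Qed.

End DiscreteMeasurable.

(** * Real-valued probabilities *)

Section Probability.
Context (d : measure_display) (X : measurableType d) (R : realType) (P : probability X R).

Definition pr (A : set X) : R := fine (P A).

Lemma prE A : measurable A -> P A = (pr A)%:E.
Proof. by move=> mA; rewrite /pr fineK// fin_num_measure. Qed.

Lemma pr_ge0 A : 0 <= pr A.
Proof. exact/fine_ge0/measure_ge0. Qed.

Lemma pr_le1 A : measurable A -> pr A <= 1.
Proof. by move=> mA; rewrite -lee_fin -prE// probability_le1. Qed.

Lemma le_pr A B : measurable A -> measurable B -> A `<=` B -> pr A <= pr B.
Proof. by move=> mA mB AB; rewrite -lee_fin -!prE// le_measure ?inE. Qed.

Lemma pr_le_add A B C : measurable A -> measurable B -> measurable C ->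
  A `<=` B `|` C -> pr A <= pr B + pr C.
Proof.
move=> mA mB mC ABC; rewrite -lee_fin EFinD -!prE//.
by apply: le_trans (measureU2 _ mB mC); rewrite le_measure ?inE//; exact: measurableU.
Qed.

Lemma pr_add A B : measurable A -> measurable B -> A `&` B = set0 ->
  pr (A `|` B) = pr A + pr B.
Proof.
move=> mA mB AB; apply: EFin_inj.
by rewrite EFinD -!prE ?measureU//; exact: measurableU.
Qed.

Lemma pr_union_bound (I : eqType) (l : seq I) A (B : I -> set X) :
  measurable A -> (forall i, measurable (B i)) ->
  (forall x, A x -> exists2 i, i \in l & B i x) -> pr A <= \sum_(i <- l) pr (B i).
Proof.
move=> mA mB; elim: l A mA => [|i l IH] A mA AB.
  rewrite (_ : A = set0) ?big_nil /pr ?measure0//.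
  by apply/seteqP; split => // x /AB[].
rewrite big_cons; apply: (@le_trans _ _ (pr (B i) + pr (A `\` B i))).
  apply: pr_le_add => //; first exact: measurableD.
  by move=> x Ax; have [|nB] := pselect (B i x); [left|right].
rewrite lerD2l; apply: IH; first exact: measurableD.
move=> x [/AB[j]]; rewrite inE => /orP[/eqP-> //|jl Bj _].
by exists j.
Qed.

End Probability.

(** * Balls and a dyadic tree in the free product *)

Fixpoint words n : seq (seq 'I_3) :=
  if n is n'.+1 then [::] :: [seq i :: v | i <- enum 'I_3, v <- words n'] else [:: [::]].

Lemma mem_words n (w : seq 'I_3) : (size w <= n)%N -> w \in words n.
Proof.
elim: n w => [|n IH] [|i v] //= vn; rewrite inE /=.
by apply/allpairsP; exists (i, v); rewrite /= mem_enum IH.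
Qed.

Definition word_ball n : seq W := [seq word_prod w | w <- words n].

Lemma mem_word_ball n (g : W) : (size g <= n)%N -> g \in word_ball n.
Proof. by move=> gn; apply/mapP; exists (c2word g); rewrite ?mem_words ?word_prodK. Qed.

(** Words alternating between the first letter and one of the two others are
    reduced, whatever the choices: this embeds binary words in W. *)
Fixpoint zigzag (l : seq bool) : seq 'I_3 :=
  if l is b :: l' then ord0 :: (if b then 1 else 2) :: zigzag l' else [::].

Lemma zigzag_reduced l : reduced (zigzag l).
Proof.
suff H (j : 'I_3) : j != ord0 -> path (fun i j : 'I_3 => i != j) j (zigzag l).
  by case: l H => //= b l H; case: b H => /= H; rewrite /reduced /=;
    have := H 1 isT; case/andP.
by elim: l j => //= b l IH j ->; case: b; rewrite /= IH.
Qed.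

Lemma zigzag_inj : injective zigzag.
Proof.
elim=> [|b l IH] [|b' l'] //= [] e /IH ->.
by case: b b' e => -[].
Qed.

Lemma size_zigzag l : size (zigzag l) = (size l).*2.
Proof. by elim: l => //= b l ->. Qed.

Definition tree n : seq W :=
  [seq C2Free (zigzag_reduced (tval t)) | t <- enum {: n.-tuple bool}].

Lemma tree_uniq n : uniq (tree n).
Proof.
rewrite map_inj_uniq ?enum_uniq // => t t' e.
by apply: val_inj; apply: zigzag_inj; exact: (congr1 (@c2word 3) e).
Qed.

Lemma size_tree n : size (tree n) = (2 ^ n)%N.
Proof. by rewrite size_map -cardE card_tuple card_bool. Qed.

Lemma tree_size n g : g \in tree n -> size g = n.*2.
Proof. by case/mapP => t _ ->; rewrite /= size_zigzag size_tuple. Qed.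

(** * Measure-preserving actions *)

Section Dynamics.
Context (d : measure_display) (X : measurableType d) (R : realType) (P : probability X R).
Variable act : Gamma -> X -> X.
Hypothesis act1 : forall x, act 1%g x = x.
Hypothesis actM : forall g h x, act (g * h)%g x = act g (act h x).
Hypothesis measurable_act : forall g, measurable_fun setT (act g).
Hypothesis act_preserves : forall g A, measurable A -> P (act g @^-1` A) = P A.

Local Notation pr := (pr P).
Local Notation tact := (tact act).
Local Notation walk := (walk act).
Local Notation slide := (slide act).
Implicit Types (F S : X -> option 'Z_3) (w : W) (A : set X).

Lemma dmeas_tact T (F : X -> T) w : dmeas F -> dmeas (fun x => F (tact w x)).
Proof.
move=> mF Y; rewrite -[X in measurable X]setTI.
exact: (measurable_act (w, 1%g) measurableT (mF Y)).
Qed.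

Lemma pr_tact w A : measurable A -> pr [set x | A (tact w x)] = pr A.
Proof. by move=> mA; rewrite /pr -(act_preserves (w, 1%g) mA). Qed.

Lemma dmeas_blocked i F c : dmeas F -> dmeas (fun x => blocked act i F x c).
Proof.
move=> mF; rewrite (_ : (fun _ => _) = fun x => has (fun j =>
    (fun j x => (j != i) && (F (tact (c2gen j) x) == Some c)) j x) (enum 'I_3)).
  apply: dmeas_has => j.
  exact: (dmeas_comp (fun o => (j != i) && (o == Some c)) (dmeas_tact (c2gen j) mF)).
apply/funext => x; apply/existsP/hasP => [[j H]|[j _ H]]; 
  first by exists j; rewrite ?mem_enum.
by exists j.
Qed.

Lemma dmeas_slide S i F : dmeas S -> dmeas F -> dmeas (slide S i F).
Proof.
move=> mS mF; rewrite /slide.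
apply: (@dmeas_bind _ X (option 'Z_3) _ S (fun s x =>
  if s is Some c then Some (first_free (blocked act i F x) c) else
  if S (tact (c2gen i) x) is Some _ then None else F x)) => // -[c|]; last first.
  apply: (@dmeas_bind _ X (option 'Z_3) _ (fun x => S (tact (c2gen i) x))
    (fun s x => if s is Some _ then None else F x)); first exact: dmeas_tact.
  by case=> // c; exact: dmeas_cst.
rewrite /first_free.
apply: (@dmeas_bind _ X bool _ (fun x => blocked act i F x c)
  (fun b x => Some (if ~~ b then c else _))); first exact: dmeas_blocked.
case=> /=; last exact: dmeas_cst.
apply: (dmeas_comp (fun b : bool => Some (if ~~ b then c + 1 else c + 1 + 1))).
exact: dmeas_blocked.
Qed.

Lemma dmeas_walk S (v : seq 'I_3) F : dmeas S -> dmeas F -> dmeas (walk S v F).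
Proof.
move=> mS mF; elim: v => //= i v IH; apply: dmeas_slide => //.
exact: dmeas_tact.
Qed.

Lemma dmeas_active S F w : dmeas S -> dmeas F -> dmeas (active act S F w).
Proof.
move=> mS mF; apply: (@dmeas_bind _ X (option 'Z_3) _ F (fun s x =>
  if s is None then if F (tact w x) is None then S x else None else None)) => // -[c|].
  exact: dmeas_cst.
apply: (@dmeas_bind _ X (option 'Z_3) _ (fun x => F (tact w x)) (fun s x =>
  if s is None then S x else None)); first exact: dmeas_tact.
by case=> // c; exact: dmeas_cst.
Qed.

Definition holes F := pr [set x | F x = None].
Definition disagree F G := pr [set x | F x <> G x].
Definition occupancy S := pr [set x | S x <> None].

Lemma disagree_triangle F G H : dmeas F -> dmeas G -> dmeas H ->
  disagree F H <= disagree F G + disagree G H.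
Proof.
move=> mF mG mH; apply: pr_le_add; try exact: (dmeas_set2 (fun a b => a <> b)).
by move=> x /= FH; have [FG|] := pselect (F x = G x); [right; rewrite -FG|left].
Qed.

(** A slide changes the acting points and their neighbours along the edge only. *)
Lemma disagree_slide S i F : dmeas S -> dmeas F -> disagree (slide S i F) F <= 2 * occupancy S.
Proof.
move=> mS mF; rewrite mulr_natl mulr2n.
rewrite /occupancy -{2}(@pr_tact (c2gen i) [set x | S x <> None]);
  last exact: (dmeas_set (fun s => s <> None)).
apply: pr_le_add => /=.
- by apply: (dmeas_set2 (fun a b => a <> b)) => //; exact: dmeas_slide.
- exact: (dmeas_set (fun s => s <> None)).
- exact: (dmeas_set (fun s => s <> None) (dmeas_tact (c2gen i) mS)).
move=> x /= FH; have [Sx|] := pselect (S x = None); last by left.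
by right=> Sax; apply: FH; exact: slide_eq.
Qed.

Lemma occupancy_translate S v : dmeas S -> occupancy (translate act S v) = occupancy S.
Proof.
move=> mS; rewrite /occupancy -(@pr_tact v^-1%g [set x | S x <> None]) //.
exact: (dmeas_set (fun s => s <> None)).
Qed.

Lemma disagree_walk S (v : seq 'I_3) F : dmeas S -> dmeas F ->
  disagree (walk S v F) F <= (2 * size v)%:R * occupancy S.
Proof.
move=> mS mF; elim: v => [|i v IH] /=.
  rewrite mul0r (_ : disagree F F = 0) // /disagree.
  rewrite (_ : [set _ | _] = set0) /pr ?measure0//.
  by apply/seteqP; split => x //=; case.
have mW := dmeas_walk v mS mF.
have mT : dmeas (translate act S (word_prod v)) by exact: dmeas_tact.
apply: le_trans (disagree_triangle (dmeas_slide i mT mW) mW mF) _.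
rewrite mulnS natrD mulrDl; apply: lerD => //.
by rewrite -(occupancy_translate (word_prod v) mS); exact: disagree_slide.
Qed.

Definition partial_coloring F := [/\ dmeas F, equivariant act F & conflict_free act F].

Lemma merge_partial_coloring n S w F : partial_coloring F -> dmeas S -> equivariant act S ->
  sparse act n S -> ((size w).*2 <= n.+1)%N -> partial_coloring (merge_holes act S w F).
Proof.
move=> [mF eF pF] mS eS sS wn; split.
- by apply: dmeas_walk => //; exact: dmeas_active.
- by rewrite /merge_holes; apply: (walk_equivariant actM) => //; exact: active_equivariant.
- rewrite /merge_holes; apply: (walk_conflict_free act1 actM _ wn pF); exact: active_sparse.
Qed.

Lemma merge_subset n S w F x : sparse act n S -> (size w <= n)%N -> w != 1%g ->
  merge_holes act S w F x = None -> F x = None.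
Proof. by move=> sS wn w1 /(merge_None act1 actM sS wn w1)[]. Qed.

(** Since merging creates no hole, two holes left at displacement [w] were there
    before, so the first one was active if it was marked, and was filled. *)
Lemma merge_pair n S w F x : sparse act n S -> (size w <= n)%N -> w != 1%g ->
  merge_holes act S w F x = None -> merge_holes act S w F (tact w x) = None -> S x = None.
Proof.
move=> sS wn w1 /(merge_None act1 actM sS wn w1)[Fx +].
by move=> + /(merge_None act1 actM sS wn w1)[Fwx _]; rewrite /active Fx Fwx.
Qed.

(** Every active point is a hole that disappears, so the cost of the walk is
    bounded by the loss of hole density. *)
Lemma merge_dist n S w F : dmeas S -> dmeas F ->
  sparse act n S -> (size w <= n)%N -> w != 1%g ->
  disagree (merge_holes act S w F) F <=
    (2 * size w)%:R * (holes F - holes (merge_holes act S w F)).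
Proof.
move=> mS mF sS wn w1; have mA := dmeas_active w mS mF.
apply: le_trans (disagree_walk w mA mF) _; apply: ler_wpM2l => //.
rewrite lerBrDr -pr_add; last first.
- apply/seteqP; split => // x [/= Ax /(merge_None act1 actM sS wn w1)[]] //.
- by apply: (dmeas_set (fun s => s = None)); exact: dmeas_walk.
- exact: (dmeas_set (fun s => s <> None)).
apply: le_pr.
- apply: measurableU; first exact: (dmeas_set (fun s => s <> None)).
  by apply: (dmeas_set (fun s => s = None)); exact: dmeas_walk.
- exact: (dmeas_set (fun s => s = None)).
by move=> x /= [Ax|]; [have [] := activeP Ax | exact: merge_subset sS wn w1].
Qed.

(** Disjoint translates of a set have total measure at most 1. *)
Lemma packing A (l : seq W) : measurable A -> uniq l ->
  (forall u v x, u \in l -> v \in l -> A (tact u x) -> A (tact v x) -> u = v) ->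
  (size l)%:R * pr A <= 1.
Proof.
move=> mA ul disj.
have mT u : measurable [set x | A (tact u x)].
  rewrite -[X in measurable X]setTI.
  exact: (measurable_act (u, 1%g) measurableT mA).
pose U := fix U (l : seq W) : set X := if l is u :: l' then
  [set x | A (tact u x)] `|` U l' else set0.
have mU s : measurable (U s) by elim: s => //= u s IH; exact: measurableU.
have UP s x : U s x -> exists2 u, u \in s & A (tact u x).
  elim: s => //= u s IH [Au|/IH[v vs Av]]; first by exists u => //; rewrite mem_head.
  by exists v => //; rewrite inE vs orbT.
apply: le_trans (pr_le1 P (mU l)).
elim: l ul disj => [|u l IH] /= => [|/andP[ul unl] disj].
  by rewrite mul0r pr_ge0.
rewrite pr_add //; last first.
  apply/seteqP; split => // x [/= Au /UP[v vl Av]].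
  by move: ul; rewrite (disj u v x) ?vl// inE ?eqxx ?vl ?orbT.
rewrite pr_tact // -natr1 mulrDl mul1r addrC lerD2l; apply: IH => // v w x vl wl.
by apply: disj; rewrite inE ?vl ?wl orbT.
Qed.

(** Being equivariant, a marker breaks the C_3-symmetry at the points where it is
    defined. *)
Definition marker n S := [/\ dmeas S, equivariant act S & sparse act n S].

(** The costs of successive merges add up to a multiple of the total loss of hole
    density, because the latter telescopes; so the bound does not grow with the
    number of merges. *)
Lemma merge_all r n (Ss : nat -> X -> option 'Z_3) (l : seq (nat * W)) F :
  (forall m, marker n (Ss m)) -> (r.*2 <= n.+1)%N -> (r <= n)%N ->
  (forall p, p \in l -> (size p.2 <= r)%N /\ p.2 != 1%g) ->
  partial_coloring F -> exists F', [/\ partial_coloring F',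
    forall x, F' x = None -> F x = None,
    forall m w x, (m, w) \in l -> F' x = None -> F' (tact w x) = None -> Ss m x = None &
    disagree F' F <= (2 * r)%:R * (holes F - holes F')].
Proof.
move=> mk rn rn' + cF; elim: l => [|[m w] l IH] hl.
  exists F; split=> //; rewrite subrr mulr0 /disagree.
  rewrite (_ : [set _ | _] = set0) /pr ?measure0//.
  by apply/seteqP; split => x //=; case.
have [p pl|F1 [cF1 sub1 pair1 d1]] := IH; first by apply: hl; rewrite inE pl orbT.
have [|/= wr w1] := hl (m, w); first exact: mem_head.
have [mS eS sS] := mk m.
have wn : (size w <= n)%N := leq_trans wr rn'.
have c2 : partial_coloring (merge_holes act (Ss m) w F1).
  by apply: merge_partial_coloring sS _ => //; apply: leq_trans rn; rewrite leq_double.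
have [mF _ _] := cF; have [mF1 _ _] := cF1; have [mF2 _ _] := c2.
have sub2 x : merge_holes act (Ss m) w F1 x = None -> F1 x = None.
  exact: merge_subset sS wn w1.
exists (merge_holes act (Ss m) w F1); split => //.
- by move=> x /sub2/sub1.
- move=> m' w' x; rewrite inE => /orP[/eqP[-> ->]|ml].
    exact: merge_pair sS wn w1.
  by move=> /sub2 h1 /sub2 h2; exact: pair1 ml h1 h2.
apply: le_trans (disagree_triangle mF2 mF1 mF) _.
apply: (@le_trans _ _ ((2 * r)%:R * (holes F1 - holes (merge_holes act (Ss m) w F1)) +
  (2 * r)%:R * (holes F - holes F1))); last by rewrite -mulrDr; apply: ler_wpM2l => //; lra.
apply: lerD => //; apply: le_trans (merge_dist mS mF1 sS wn w1) _.
apply: ler_wpM2r; last by rewrite ler_nat leq_mul2l wr orbT.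
rewrite subr_ge0; apply: le_pr; [exact: (dmeas_set (fun s => s = None))..|].
by move=> x /=; exact: sub2.
Qed.

(** A quantitative form of freeness of the action. *)
Definition has_markers := forall n (e : R), 0 < e ->
  exists (M : nat) (Ss : nat -> X -> option 'Z_3), (forall m, marker n (Ss m)) /\
    pr [set x | forall m, (m < M)%N -> Ss m x = None] <= e.

Lemma measurable_unmarked n M (Ss : nat -> X -> option 'Z_3) :
  (forall m, marker n (Ss m)) ->
  measurable [set x | forall m, (m < M)%N -> Ss m x = None].
Proof.
move=> mk; rewrite (_ : [set _ | _] =
    \bigcap_(m in [set m | (m < M)%N]) [set x | Ss m x = None]).
  apply: bigcap_measurableType => m _.
  by have [mS _ _] := mk m; exact: (dmeas_set (fun s => s = None)).
by apply/seteqP; split.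
Qed.

(** After merging all pairs at distance at most 4n, a marked hole has no other hole
    within that distance.  The 2^n elements of [tree n] have length 2n, so the
    translates by them of the set of marked holes are disjoint, which bounds its
    measure by 2^-n; the unmarked points contribute another 2^-n.  Paths have
    length at most 4n, and recolour at most 8n points. *)
Lemma few_holes n F : has_markers -> partial_coloring F -> exists F', [/\ partial_coloring F',
  holes F' <= 2 * 2^-1 ^+ n & disagree F' F <= (8 * n)%:R * holes F].
Proof.
move=> markers cF; have e0 : 0 < (2^-1 : R) ^+ n by apply: exprn_gt0; rewrite invr_gt0.
have [M [Ss [mk unmarked]]] := markers (8 * n)%N _ e0.
(* All displacements of length at most 4n, which is the diameter of [tree n]. *)
pose shells := [seq w : W <- word_ball (4 * n) | (size w <= 4 * n)%N && (w != 1%g)].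
have [|||F' [cF' _ pairs dF]] := @merge_all (4 * n) (8 * n) Ss
  [seq (m, w) | m <- iota 0 M, w <- shells] F mk _ _ _ cF; try lia.
  move=> p /allpairsP[[m w] [/= _ + ->]] /=.
  by rewrite mem_filter => /andP[/andP[-> ->]].
exists F'; split=> //; last first.
  rewrite (_ : 8 * n = 2 * (4 * n))%N; last lia.
  apply: le_trans dF _; apply: ler_wpM2l => //.
  by rewrite gerBl pr_ge0.
have [mF' _ _] := cF'.
have mh : measurable [set x | F' x = None] by exact: (dmeas_set (fun s => s = None)).
pose U := [set x | forall m, (m < M)%N -> Ss m x = None].
have mU : measurable U := measurable_unmarked M mk.
have mV : measurable ([set x | F' x = None] `\` U) by exact: measurableD.
rewrite mulr_natl mulr2n; apply: (@le_trans _ _ (pr ([set x | F' x = None] `\` U) + pr U)).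
  apply: pr_le_add => // x Fx; have [Ux|Ux] := pselect (U x); first by right.
  by left.
apply: lerD => //; rewrite exprVn -[leRHS]mul1r ler_pdivlMr ?exprn_gt0// mulrC.
rewrite -natrX -(size_tree n); apply: packing (tree_uniq n) _ => // u v x ut vt [Fu Uu] [Fv _].
apply/eqP; apply: contrapT => /negP uv; apply: Uu => m mM.
apply: (pairs m (v * u^-1)%g _ _ Fu); last by rewrite -(tactM actM) mulgVK.
apply/allpairsP; exists (m, (v * u^-1)%g); split => //=; first by rewrite mem_iota.
have sz : (size (v * u^-1)%g <= 4 * n)%N.
  apply: leq_trans (size_c2mul _ _) _; rewrite size_c2inv (tree_size ut) (tree_size vt); lia.
rewrite mem_filter sz mem_word_ball // andbT.
by apply: contra uv => /eqP vu; rewrite eq_sym -(mulgVK u v) vu mul1g.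
Qed.

Lemma coloring_none : partial_coloring (fun=> None).
Proof. by split=> //; exact: dmeas_cst. Qed.

(** Stage k uses distance 8k: the density 2 * 4^-k that it leaves behind outweighs
    the factor 16(k+1) which the next stage may lose. *)
Lemma coloring_sequence : has_markers -> exists F : nat -> X -> option 'Z_3,
  [/\ forall k, partial_coloring (F k), forall k, holes (F k) <= 32 * 2^-1 ^+ k &
      forall k, disagree (F k.+1) (F k) <= 32 * 2^-1 ^+ k].
Proof.
move=> markers.
have next (k : nat) (F : {F | partial_coloring F}) : {F' : {F' | partial_coloring F'} |
    holes (sval F') <= 2 * 2^-1 ^+ (2 * k) /\
    disagree (sval F') (sval F) <= (8 * (2 * k))%:R * holes (sval F)}.
  apply: cid; case: F => F cF; have [F' [cF' hF' dF']] := few_holes (2 * k) markers cF.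
  by exists (exist _ F' cF').
pose G := fix G k : {F | partial_coloring F} :=
  if k is k'.+1 then sval (next k (G k')) else sval (next 0%N (exist _ _ coloring_none)).
have hG k : holes (sval (G k)) <= 2 * 2^-1 ^+ (2 * k).
  by case: k => [|k] /=; case: (next _ _) => F' [].
exists (fun k => sval (G k)); split=> k; first exact: svalP.
  apply: le_trans (hG k) _; apply: ler_pM; rewrite ?exprn_ge0 ?invr_ge0// ?ler_nat//.
  by apply: ler_wiXn2l; rewrite ?invr_ge0// ?invf_le1// ?ler1n// leq_pmull.
have [_] := svalP (next k.+1 (G k)); move=> /le_trans; apply.
apply: le_trans (ler_wpM2l _ (hG k)) _ => //.
have -> : (2^-1 : R) ^+ (2 * k) = 2^-1 ^+ k * 2^-1 ^+ k.
  by rewrite mul2n -addnn exprD.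
rewrite !mulrA; apply: ler_wpM2r; first by rewrite exprn_ge0// invr_ge0.
rewrite exprVn ler_pdivrMr ?exprn_gt0// -natrM -natrX -natrM ler_nat.
by have := ltn_expl k (isT : 1 < 2)%N; lia.
Qed.

(** Borel-Cantelli: almost surely only finitely many of the events that the
    k-th colour is missing or is changed at the next stage occur. *)
Lemma ae_eventually_constant (C : R) (F : nat -> X -> option 'Z_3) : 0 <= C ->
  (forall k, dmeas (F k)) -> (forall k, holes (F k) <= C * 2^-1 ^+ k) ->
  (forall k, disagree (F k.+1) (F k) <= C * 2^-1 ^+ k) ->
  {ae P, forall x, exists c N, forall k, (N <= k)%N -> F k x = Some c}.
Proof.
move=> C0 mF hF dF.
pose bad k := [set x | F k x = None] `|` [set x | F k.+1 x <> F k x].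
have mbad k : measurable (bad k).
  apply: measurableU; first exact: (dmeas_set (fun s => s = None)).
  exact: (dmeas_set2 (fun a b => a <> b)).
exists (lim_sup_set bad); split.
- by apply: bigcap_measurableType => k _; exact: bigcup_measurable.
- apply: lim_sup_set_cvg0 => //.
  apply: (@le_lt_trans _ _ ((4 * C)%:E)); last exact: ltry.
  apply: le_trans (epsilon_trick0 xpredT _); last by rewrite mulr_ge0.
  apply: lee_nneseries => // k _; rewrite [X in (X <= _)%E](prE P (mbad k)) lee_fin.
  apply: (@le_trans _ _ (C * 2^-1 ^+ k + C * 2^-1 ^+ k)).
    apply: (@le_trans _ _ (holes (F k) + disagree (F k.+1) (F k))); last exact: lerD.
    apply: pr_le_add => //; first exact: (dmeas_set (fun s => s = None)).
    exact: (dmeas_set2 (fun a b => a <> b)).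
  rewrite expnS natrM natrX invfM -exprVn; lra.
move=> x /= unsettled; apply: contrapT => nx; apply: unsettled.
have [N nbad] : exists N, forall k, (N <= k)%N -> ~ bad k x.
  apply: contrapT => H; apply: nx => N _ /=; apply: contrapT => H'.
  by apply: H; exists N => k Nk bk; apply: H'; exists k.
have [c FN] : exists c, F N x = Some c.
  case e: (F N x) => [c|]; first by exists c.
  by case: (nbad N (leqnn _)); left.
exists c, N => // k /= Nk; rewrite -(subnKC Nk); elim: (k - N)%N => [|j <-].
  by rewrite addn0.
rewrite addnS; apply: contrapT => H; apply: (nbad (N + j)%N (leq_addr _ _)).
by right.
Qed.

(** A countable group moves a null set around in a null set. *)
Lemma ae_orbit (Q : X -> Prop) : {ae P, forall x, Q x} ->
  {ae P, forall x, forall g, Q (act g x)}.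
Proof.
move=> [Z [mZ Z0 nQ]].
have ae_one g : {ae P, forall x, Q (act g x)}.
  exists (act g @^-1` Z); split.
    by rewrite -[X in measurable X]setTI; exact: measurable_act.
    by rewrite act_preserves.
  by move=> x nQx; exact: (nQ (act g x)).
have : {ae P, forall x, forall n, if unpickle n is Some wk
    then Q (act (word_prod wk.1, wk.2 : 'Z_3) x) else True}.
  apply/ae_foralln => n; case: unpickle => [[w k]|]; first exact: ae_one.
  exact: aeW.
apply: filterS => x Qx h; have := Qx (pickle (c2word h.1, h.2 : 'Z_3)).
by rewrite pickleK /= word_prodK; case: h.
Qed.

(** For an action with markers the colourings of vanishing hole density converge
    to a colouring without holes. *)
Lemma limit_coloring : has_markers -> exists F : X -> 'Z_3, dmeas F /\
  {ae P, forall x, forall g : Gamma, F (turn act (act g x)) = F (act g x) + 1 /\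
    forall i, F (tact (c2gen i) (act g x)) <> F (act g x)}.
Proof.
move=> /coloring_sequence[F [cF hF dF]].
have mF k : dmeas (F k) by have [] := cF k.
have [L [mL LE]] := dmeas_limit mF; exists L; split=> //.
have := ae_orbit (ae_eventually_constant (ler0n R 32) mF hF dF).
apply: filterS => x settled g.
have [c [N FN]] := settled g; rewrite (LE _ _ _ FN); split.
  apply: (LE _ _ N) => k Nk; have [_ eF _] := cF k.
  by rewrite eF FN.
move=> i; have := settled ((c2gen i, 1%g) * g)%g; rewrite actM => -[c' [N' FN']].
rewrite (LE _ _ _ FN') => cc'; have [_ _ pF] := cF (maxn N N').
apply: (pF i (act g x) c); first by rewrite FN ?leq_maxl.
by rewrite FN' ?leq_maxr// cc'.
Qed.

End Dynamics.

(** * Product measures and the shift *)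

Lemma shift1 (G : groupType) T (x : G -> T) : shift 1%g x = x.
Proof. by apply/funext => h; rewrite /shift mulg1. Qed.

Lemma shiftM (G : groupType) T (g h : G) (x : G -> T) :
  shift (g * h)%g x = shift g (shift h x).
Proof. by apply/funext => k; rewrite /shift mulgA. Qed.

Lemma measurable_coordinate I d (T : measurableType d) (i : I) (A : set T) :
  measurable A -> measurable [set x : prodM I T | A (x i)].
Proof. by move=> mA; apply: sub_sigma_algebra; exists i, A. Qed.

Lemma measurable_shift d (T : measurableType d) (G : groupType) (g : G) :
  measurable_fun setT (shift g : prodM G T -> prodM G T).
Proof.
apply: (@measurability _ _ (prodM G T) (prodM G T) setT (shift g) (@cylinders G d T)) => //.
move=> _ [_ [i [A [mA ->]]] <-].
by rewrite setTI; exact: (measurable_coordinate (i * g)%g mA).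
Qed.

Section ProductMeasure.
Context (R : realType) (G : groupType) (d : measure_display) (T : measurableType d).
Context (mu : set T -> \bar R) (P : probability (prodM G T) R).
Hypothesis hP : is_product_measure mu P.

Definition box (J : seq G) (A : G -> set T) : set (prodM G T) :=
  [set x | forall i, i \in J -> A i (x i)].

Definition boxes : set (set (prodM G T)) :=
  [set C | exists J A, [/\ uniq J, (forall i, measurable (A i)) & C = box J A]].

Lemma measurable_box J A : (forall i, measurable (A i)) -> measurable (box J A).
Proof.
move=> mA; elim: J => [|i J IH].
  by rewrite (_ : box _ _ = setT) //; apply/seteqP; split.
rewrite (_ : box _ _ = [set x | A i (x i)] `&` box J A).
  by apply: measurableI => //; exact: measurable_coordinate.
apply/seteqP; split => [x Ax|x [Ai AJ] j]; last first.
  by rewrite inE => /orP[/eqP->//|]; exact: AJ.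
by split; [apply: Ax; rewrite mem_head|move=> j jJ; apply: Ax; rewrite inE jJ orbT].
Qed.

Lemma boxesI : setI_closed boxes.
Proof.
move=> _ _ [J [A [uJ mA ->]]] [K [B [uK mB ->]]].
exists (undup (J ++ K)),
  (fun i => (if i \in J then A i else setT) `&` (if i \in K then B i else setT)).
split; first exact: undup_uniq.
  by move=> i; apply: measurableI; case: ifP.
apply/seteqP; split => x.
  move=> [Ax Bx] i _; split; case: ifPn => // ?; [exact: Ax|exact: Bx].
move=> H; split=> i iJ; have := H i; rewrite mem_undup mem_cat iJ ?orbT => /(_ isT)[] //.
Qed.

Lemma boxes_generate : @measurable _ (prodM G T) = <<s boxes >>.
Proof.
apply/seteqP; split.
  apply: smallest_sub => [|_ [i [A [mA ->]]]]; first exact: smallest_sigma_algebra.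
  apply: sub_sigma_algebra; exists [:: i], (fun=> A); split => //.
  by apply/seteqP; split => x /=; [move=> Ax j; rewrite inE => /eqP->|apply; rewrite inE].
apply: smallest_sub; first exact: sigma_algebra_measurable.
by move=> _ [J [A [_ mA ->]]]; exact: measurable_box.
Qed.

(** Translating a box permutes its coordinates, which all have the same law, and
    boxes form a pi-system. *)
Lemma shift_preserves (g : G) (A : set (prodM G T)) :
  measurable A -> P (shift g @^-1` A) = P A.
Proof.
move=> mA; have ms := @measurable_shift _ T G g.
apply/esym; apply: (@measure_unique _ R _ boxes (fun=> setT) boxes_generate boxesI _ _ P
  (measure_function_pushforward__canonical__measure_function_Measure P ms)) => //.
- by move=> _; exists [::], (fun=> setT); split=> //; apply/seteqP; split.
- by rewrite bigcup_const //; exists 0%N.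
- move=> _ [J [B [uJ mB ->]]].
  have inj : injective (fun i : G => (i * g)%g) by move=> i j; exact: mulIg.
  rewrite /= /pushforward [LHS]hP //.
  rewrite (_ : _ @^-1` _ = box [seq (i * g)%g | i <- J] (fun j => B (j * g^-1)%g)).
    rewrite [RHS]hP ?map_inj_uniq // big_map.
    by apply: eq_bigr => i _; rewrite mulgK.
  apply/seteqP; split => x.
    by move=> Bx _ /mapP[i iJ ->]; rewrite mulgK; exact: Bx.
  by move=> Bx i iJ; have := Bx (i * g)%g (map_f _ iJ); rewrite mulgK.
- by move=> _; rewrite [X in (X < _)%E]probability_setT ltry.
Qed.

Lemma pair_coordinates (g h : G) (A B : set T) : g != h -> measurable A -> measurable B ->
  P [set x | A (x g) /\ B (x h)] = (mu A * mu B)%E.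
Proof.
move=> gh mA mB; have := hP (J := [:: g; h]) (A := fun i => if i == g then A else B).
rewrite /= inE gh /= !big_cons big_nil eqxx eq_sym (negPf gh) mule1 => <- //; last first.
  by move=> i; case: ifP.
congr (P _); apply/seteqP; split => x /=.
  by move=> [Ax Bx] i; rewrite !inE => /orP[/eqP->|/eqP->]; rewrite ?eqxx // eq_sym (negPf gh).
move=> H; have := H g; have := H h; rewrite !inE !eqxx eq_sym (negPf gh) orbT /=.
by move=> /(_ isT) ? /(_ isT).
Qed.

End ProductMeasure.

(** * Digits of a label *)

Section Digits.
Variable R : realType.
Implicit Types (t : unit_interval R) (N m : nat).

Definition digit N t : nat := Num.truncn (N%:R * ival t).

Lemma ival_bounds t : 0 <= ival t <= 1.
Proof. by have := svalP t; rewrite in_itv. Qed.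

Definition cell N m : set (unit_interval R) := [set t | digit N t = m].

Lemma cellE N m : (0 < N)%N ->
  cell N m = @ival R @^-1` [set` `[(m%:R / N%:R : R), (m.+1%:R / N%:R)[%R].
Proof.
move=> N0; have N0' : (0 : R) < N%:R by rewrite ltr0n.
apply/seteqP; split => t; rewrite /cell /digit /= in_itv /= ler_pdivrMr // ltr_pdivlMr //
  mulrC -truncn_eq ?mulr_ge0//; by [move=> ->|move=> /eqP|have /andP[] := ival_bounds t].
Qed.

Lemma measurable_cell N m : (0 < N)%N -> measurable (cell N m).
Proof.
move=> N0; rewrite cellE //; exists [set` `[(m%:R / N%:R : R), (m.+1%:R / N%:R)[%R].
  exact: measurable_itv.
by rewrite setTI.
Qed.

Lemma dmeas_digit N : (0 < N)%N -> dmeas (digit N).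
Proof. by move=> N0; apply: dmeas_nat => m; exact: measurable_cell. Qed.

Lemma lebesgue01_cell N m : (0 < N)%N -> (lebesgue01 (cell N m) <= (N%:R^-1)%:E)%E.
Proof.
move=> N0; pose I := [set` `[(m%:R / N%:R : R), (m.+1%:R / N%:R)[%R].
have N0' : (0 : R) < N%:R by rewrite ltr0n.
apply: (@le_trans _ _ (lebesgue_measure I)).
  rewrite /lebesgue01 cellE // (_ : image _ _ = I `&` [set` `[0, 1]%R]); last first.
    apply/seteqP; split => [_ [t It <-]|r [Ir r01]].
      by split=> //; exact: svalP.
    by exists (exist _ r r01).
  apply: le_measure; rewrite ?inE; [|exact: measurable_itv|exact: subIsetl].
  by apply: measurableI; exact: measurable_itv.
rewrite lebesgue_measure_itv /= lte_fin ltr_pM2r ?invr_gt0// ltr_nat leqnn.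
by rewrite -EFinB lee_fin -mulrBl -natrB ?leqnSn// subSnn mul1r.
Qed.

(** The value N is attained, at the end point 1. *)
Lemma digit_le N t : (digit N t <= N)%N.
Proof.
have /andP[t0 t1] := ival_bounds t.
rewrite truncn_le_nat -natr1; apply: (@le_lt_trans _ _ N%:R); last by rewrite ltrDl.
by rewrite -[leRHS]mulr1; apply: ler_wpM2l.
Qed.

End Digits.

(** * Markers for the label space *)

Section Labels.
Context (R : realType) (P : probability (prodM Gamma (unit_interval R)) R).
Hypothesis hP : is_product_measure (@lebesgue01 R) P.
Local Notation X := (prodM Gamma (unit_interval R)).

Lemma dmeas_digit_at N (g : Gamma) : (0 < N)%N -> dmeas (fun x : X => digit N (x g)).
Proof. by move=> N0 Y; exact: (measurable_coordinate g (dmeas_digit R N0 Y)). Qed.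

Lemma lebesgue01_ge0 A : (0 <= @lebesgue01 R A)%E.
Proof. exact: measure_ge0. Qed.

(** There are N+1 cells, each of mass at most 1/N. *)
Lemma collision N (g h : Gamma) : (0 < N)%N -> g != h ->
  pr P [set x | digit N (x g) = digit N (x h)] <= 2 / N%:R.
Proof.
move=> N0 gh; have N0' : (0 : R) < N%:R by rewrite ltr0n.
pose B m := [set x : X | cell N m (x g) /\ cell N m (x h)].
have mB m : measurable (B m).
  by apply: measurableI; apply: measurable_coordinate; exact: measurable_cell.
apply: (@le_trans _ _ (\sum_(m <- iota 0 N.+1) pr P (B m))).
  apply: pr_union_bound => //.
    by apply: (dmeas_set2 (fun a b : nat => a = b)); exact: dmeas_digit_at.
  move=> x /= e; exists (digit N (x g)); last by split.
  by have := mem_iota 0 N.+1 (digit N (x g)); rewrite /= add0n ltnS digit_le => ->.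
have PB m : pr P (B m) <= N%:R^-1 * N%:R^-1.
  rewrite -lee_fin -prE // (pair_coordinates hP gh) ?EFinM; [|exact: measurable_cell..].
  by apply: lee_pmul; rewrite ?lebesgue01_ge0 ?lebesgue01_cell.
apply: le_trans (ler_sum _ (fun m _ => PB m)) _.
rewrite big_const_seq count_predT size_iota iter_addr_0 -[_ *+ N.+1]mulr_natl mulrA.
apply: ler_wpM2r; first by rewrite invr_ge0 ltW.
by rewrite ler_pdivrMr // -natrM ler_nat; lia.
Qed.

Definition region n : seq Gamma := [seq (w, k) : Gamma | w <- word_ball n, k <- enum 'Z_3].

Lemma mem_region n w k : (size (w : W) <= n)%N -> (w, k) \in region n.
Proof.
by move=> wn; apply/allpairsP; exists (w, k); rewrite /= mem_word_ball // mem_enum.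
Qed.

(** In the part of [region n] around x, the digit m occurs exactly once, and this at
    the element b^-c of the triangle of x.  The sign is due to b x reading the
    labels of x one step further along the triangle, which lowers the position
    by 1 where the reference colour has to increase by 1. *)
Definition centred n N m (x : X) (c : 'Z_3) : bool :=
  all (fun g : Gamma => (digit N (x g) == m) == (g == (1%g, - c))) (region n).

Definition mark n N m (x : X) : option 'Z_3 :=
  ohead [seq c <- enum 'Z_3 | centred n N m x c].

Lemma centred_turn n N m x c :
  centred n N m (shift gen_b x) c = centred n N m x (c - 1).
Proof.
have shiftE (w : W) (k : 'Z_3) : shift gen_b x (w, k) = x (w, k + 1).
  by congr x; congr (_, _); exact: mulg1.
apply/allP/allP => H _ /allpairsP[[w k] /= [wn _ ->]].
  have /H : (w, k - 1) \in region n.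
    by apply/allpairsP; exists (w, k - 1); rewrite /= mem_enum wn.
  by rewrite shiftE subrK !xpair_eqE subr_eq opprB addrC (addrC 1).
have /H : (w, k + 1) \in region n.
  by apply/allpairsP; exists (w, k + 1); rewrite /= mem_enum wn.
by rewrite shiftE !xpair_eqE opprB (addrC 1) (inj_eq (addIr 1)).
Qed.

Lemma mark_centred n N m x c : mark n N m x = Some c -> centred n N m x c.
Proof.
rewrite /mark; case E: [seq _ <- _ | _] => [//|c' l] /= [<-].
have : c' \in [seq c <- enum 'Z_3 | centred n N m x c] by rewrite E mem_head.
by rewrite mem_filter => /andP[].
Qed.

Lemma centred_mark n N m x c : centred n N m x c -> mark n N m x = Some c.
Proof.
move=> cc; case E: (mark n N m x) => [c'|]; last first.
  move: E; rewrite /mark; case E: [seq _ <- _ | _] => [|//] _.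
  have : c \in [seq c <- enum 'Z_3 | centred n N m x c] by rewrite mem_filter cc mem_enum.
  by rewrite E.
have /allP/(_ (1%g, - c))/= := mark_centred E; rewrite mem_region // => /(_ isT).
have /allP/(_ (1%g, - c))/= := cc; rewrite mem_region // => /(_ isT).
by rewrite eqxx => /eqP -> /eqP/esym; rewrite xpair_eqE eqr_opp => /andP[_ /eqP->].
Qed.

(** Were x and w x both marked, the occurrence of m that centres w x would be a
    second one in the region around x. *)
Lemma mark_is_marker n N m : (0 < N)%N -> @marker _ X (@shift _ _) n (mark n N m).
Proof.
move=> N0; split.
- apply: (dmeas_comp ohead); apply: dmeas_filter => c.
  rewrite (_ : (fun _ => _) = fun x => ~~ has
      ((fun (g : Gamma) (x : X) => (digit N (x g) == m) != (g == (1%g, - c)))^~ x) (region n)).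
    apply: (dmeas_comp negb); apply: dmeas_has => g.
    exact: (dmeas_comp (fun a => (a == m) != (g == (1%g, - c))) (dmeas_digit_at g N0)).
  by apply/funext => x; rewrite -all_predC; apply: eq_all => g /=; rewrite negbK.
- move=> x; case E: (mark n N m x) => [c|] /=.
    by apply: centred_mark; rewrite /turn centred_turn addrK; exact: mark_centred.
  case E': (mark n N m _) => [c|//]; have := mark_centred E'.
  by rewrite /turn centred_turn => /centred_mark; rewrite E.
move=> w wn w1 x; case E: (mark n N m x) => [c|//] _.
case E': (mark n N m _) => [c'|//].
have /allP/(_ (w, - c')) := mark_centred E; rewrite mem_region // => /(_ isT) /eqP.
have /allP/(_ (1%g, - c')) := mark_centred E'; rewrite mem_region // => /(_ isT).
rewrite eqxx /tact /shift (_ : ((1, - c') * (w, 1))%g = (w, - c')) => [/eqP ->|].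
  by move/esym; rewrite xpair_eqE (negPf w1).
by congr (_, _); rewrite ?mul1g //; exact: mulg1.
Qed.

(** The digit of x at 1 fails to mark x only if it recurs at another element of the
    region, and a union bound applies. *)
Lemma markers : @has_markers _ X _ P (@shift _ _).
Proof.
move=> n e e0; pose L := [seq g <- region n | g != 1%g].
(* Fine enough for the union bound: size L collisions, each of probability at most 2/N. *)
pose N := (Num.truncn (2 * (size L)%:R / e)).+1.
have N0' : (0 : R) < N%:R by rewrite ltr0n.
exists N.+1, (mark n N); split; first by move=> m; exact: mark_is_marker.
pose B (g : Gamma) := [set x : X | digit N (x g) = digit N (x 1%g)].
have mB g : measurable (B g).
  by apply: (dmeas_set2 (fun a b : nat => a = b)); exact: dmeas_digit_at.
apply: (@le_trans _ _ (\sum_(g <- L) pr P (B g))).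
  apply: pr_union_bound => // [|x unmarked].
    by apply: measurable_unmarked => m; exact: mark_is_marker.
  have : ~~ centred n N (digit N (x 1%g)) x 0.
    apply/negP => /centred_mark; rewrite unmarked //.
    by rewrite ltnS digit_le.
  case/allPn => g gn; rewrite oppr0 => ng; have g1 : g != 1%g.
    by apply: contraNN ng => /eqP ->; rewrite !eqxx.
  exists g; first by rewrite mem_filter g1.
  have g0 : (g == (1%g, 0)) = false := negPf g1.
  by move: ng; rewrite g0 eqbF_neg negbK => /eqP.
apply: (@le_trans _ _ (\sum_(g <- L) 2 / N%:R)).
  rewrite big_seq [leRHS]big_seq; apply: ler_sum => g.
  by rewrite mem_filter => /andP[g1 _]; exact: collision.
rewrite big_const_seq count_predT iter_addr_0 -[_ *+ size L]mulr_natl mulrA ler_pdivrMr //.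
have := truncnS_gt (2 * (size L)%:R / e); rewrite ltr_pdivrMr // -/N.
by rewrite mulrC [e * _]mulrC; exact: ltW.
Qed.

Lemma measurable_equivariant_map (L : X -> 'Z_3) : dmeas L ->
  @measurable_fun _ _ X (prodM Gamma color) setT (fun x g => L (shift g x)).
Proof.
move=> mL.
apply: (@measurability _ _ X (prodM Gamma color) setT _ (@cylinders Gamma _ color)) => //.
move=> _ [_ [g [A [_ ->]]] <-].
exact: (measurable_shift g measurableT (mL A)).
Qed.

End Labels.

(** * The colouring *)

Theorem theorem4p7 (R : realType)
    (P : probability (prodM Gamma (unit_interval R)) R)
    (hP : is_product_measure (@lebesgue01 R) P) :
  exists f : prodM Gamma (unit_interval R) -> prodM Gamma color,
    is_fiid_3coloring genE P f.
Proof.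
have [L [mL good]] := @limit_coloring _ (prodM Gamma (unit_interval R)) R P
  (@shift Gamma (unit_interval R)) (@shift1 _ _) (@shiftM _ _)
  (@measurable_shift _ _ Gamma) (shift_preserves hP) (markers hP).
exists (fun x g => L (shift g x)); split.
- exact: measurable_equivariant_map.
- by apply: aeW => x g; apply/funext => h; exact: (congr1 L (esym (shiftM h g x))).
apply: filterS good => x good.
have step e h : genE e -> L (shift (e * h)%g x) <> L (shift h x).
  have [Lb La] := good h.
  by case=> [[i ->]|->]; rewrite shiftM; [exact: La | rewrite Lb; case: (L _) => -[|[|[|]]]].
move=> y z [g [Eg|Eg] ->]; first by move/esym; exact: step.
by rewrite -{1}(mulKg g y); exact: step.
Qed.
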